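(* Let $n\ge 2$ and let $(\mathfrak g,[\cdot,\cdot],\alpha)$ be a multiplicative Hom-Lie algebra over $\mathbb K$. Define the $n$-linear map $$[x_1,\dots,x_n]_n=\Big[\big[\cdots\big[[[x_1,x_2],\alpha(x_3)],\alpha^2(x_4)\big]\cdots,\alpha^{n-3}(x_{n-1})\big],\alpha^{n-2}(x_n)\Big],\qquad x_1,\dots,x_n\in\mathfrak g .$$ Then $\mathfrak g_n=(\mathfrak g,[\cdot,\dots,\cdot]_n,\alpha^{n-1})$ is a multiplicative Hom-Lie $n$-uplet system.
   Context: $\mathbb K$ is an algebraically closed field of characteristic zero. A Hom-Lie algebra is a triple $(\mathfrak g,[\cdot,\cdot],\alpha)$ with $[\cdot,\cdot]:\mathfrak g\times\mathfrak g\to\mathfrak g$ bilinear, $\alpha:\mathfrak g\to\mathfrak g$ linear, such that $[x,y]=-[y,x]$ and $[\alpha(x),[y,z]]+[\alpha(y),[z,x]]+[\alpha(z),[x,y]]=0$. It is multiplicative if $\alpha([x,y])=[\alpha(x),\alpha(y)]$. $\alpha^k$ denotes $k$-fold composition, $\alpha^0=\mathrm{id}$. For $n=2$, $[x_1,x_2]_2=[x_1,x_2]$; in general $[x_1,\dots,x_n]_n=[[x_1,\dots,x_{n-1}]_{n-1},\alpha^{n-2}(x_n)]$ for $n\ge3$. A multiplicative Hom-Lie $n$-uplet system $(\mathcal G,[\cdot,\dots,\cdot],\beta)$ is a vector space $\mathcal G$ with an $n$-linear map $[\cdot,\dots,\cdot]:\mathcal G^n\to\mathcal G$ and a linear map $\beta:\mathcal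 G\to\mathcal G$ such that, for all elements of $\mathcal G$: (1) $[x,x,y_1,\dots,y_{n-2}]=0$; (2) $[\beta(x_1),\dots,\beta(x_{n-1}),[y_1,\dots,y_n]]=\sum_{i=1}^n[\beta(y_1),\dots,\beta(y_{i-1}),[x_1,\dots,x_{n-1},y_i],\beta(y_{i+1}),\dots,\beta(y_n)]$; (3) $\beta([x_1,\dots,x_n])=[\beta(x_1),\dots,\beta(x_n)]$. *)

(* Defs.v *)
From HB Require Import structures.
From mathcomp Require Import all_boot all_order all_algebra.

Set Implicit Arguments.
Unset Strict Implicit.
Unset Printing Implicit Defensive.

Import GRing.Theory.
Local Open Scope ring_scope.

Record mult_homLie_algebra (K : fieldType) (V : lmodType K)
    (br : {bilinear V -> V -> V}) (alpha : {linear V -> V}) : Prop := {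
  homLie_skew : forall x y : V, br x y = - br y x;
  homLie_jacobi : forall x y z : V,
    br (alpha x) (br y z) + br (alpha y) (br z x) + br (alpha z) (br x y) = 0;
  homLie_mult : forall x y : V, alpha (br x y) = br (alpha x) (alpha y)
}.

(* (x_1, ..., x_n) with its i-th entry replaced by v *)
Definition fupdate (T : Type) n (x : {ffun 'I_n -> T}) (i : 'I_n) (v : T) :
    {ffun 'I_n -> T} :=
  [ffun j => if j == i then v else x j].

(* (x_1, ..., x_{n-1}, z), for n >= 1 *)
Definition fsnoc (T : Type) n (x : {ffun 'I_n.-1 -> T}) (z : T) :
    {ffun 'I_n -> T} :=
  [ffun i : 'I_n => oapp x z (insub (val i))].

Definition fmap (T : Type) n (f : T -> T) (x : {ffun 'I_n -> T}) :
    {ffun 'I_n -> T} :=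
  [ffun i => f (x i)].

Definition multilinear (K : fieldType) (V : lmodType K) n
    (op : {ffun 'I_n -> V} -> V) : Prop :=
  forall (x : {ffun 'I_n -> V}) (i : 'I_n),
    linear (fun v : V => op (fupdate x i v)).

(* Meaningful for n >= 2 only. *)
Record mult_homLie_nuplet_system (K : fieldType) (V : lmodType K) n
    (op : {ffun 'I_n -> V} -> V) (beta : V -> V) : Prop := {
  nuplet_multilinear : multilinear op;
  nuplet_linear : linear beta;
  nuplet_alt : forall (x : {ffun 'I_n -> V}) (i j : 'I_n),
    val i = 0%N -> val j = 1%N -> x i = x j -> op x = 0;
  nuplet_jacobi : forall (x : {ffun 'I_n.-1 -> V}) (y : {ffun 'I_n -> V}),
    op (fsnoc (fmap beta x) (op y)) =
    \sum_(i < n) op (fupdate (fmap beta y) i (op (fsnoc x (y i))));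
  nuplet_mult : forall x : {ffun 'I_n -> V}, beta (op x) = op (fmap beta x)
}.

(* For n >= 2, with n = k.+1, this is
   [x_1, ..., x_n]_n = [[x_1, ..., x_{n-1}]_{n-1}, alpha^(n-2) (x_n)],
   with the conventions [x_1]_1 = x_1 and [ ]_0 = 0; in particular
   [x_1, x_2]_2 = [x_1, x_2]. *)
Fixpoint iterated_bracket (K : fieldType) (V : lmodType K)
    (br : {bilinear V -> V -> V}) (alpha : {linear V -> V}) (n : nat) :
    {ffun 'I_n -> V} -> V :=
  match n with
  | 0 => fun=> 0
  | k.+1 => fun x : {ffun 'I_k.+1 -> V} =>
      if k is 0 then x ord_max
      else br (iterated_bracket br alpha
                 [ffun i : 'I_k => x (widen_ord (leqnSn k) i)])
              (iter k.-1 alpha (x ord_max))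
  end.

(* Main.v *)
(** Write [b_m] for the [m]-fold iterated bracket.  The generalized Jacobi
    identity is the case [m = n], [u = b_(n-1)(x)], [z_i = alpha^(n-2)(y_i)] of
      [[alpha^(m-1) u, b_m(z)] =
         \sum_i b_m(alpha z_1, ..., [u, z_i], ..., alpha z_m)],
    which follows by induction on [m] from the Hom-Jacobi identity, read as the
    rule [[alpha a, [b, c]] = [[a, b], alpha c] + [alpha b, [a, c]]]. *)
Require Import Defs.
From mathcomp Require Import all_boot all_order all_algebra.

Set Implicit Arguments.
Unset Strict Implicit.
Unset Printing Implicit Defensive.

Import GRing.Theory.
Local Open Scope ring_scope.

(** The body repeats the restriction inside [iterated_bracket] verbatim, so that the recursion
    equation [iterated_bracketS] holds by computation. *)
Definition finit {T : Type} {n} (x : {ffun 'I_n.+1 -> T}) : {ffun 'I_n -> T} :=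
  [ffun i => x (widen_ord (leqnSn n) i)].

Lemma finit_fmap (T : Type) n (f : T -> T) (x : {ffun 'I_n.+1 -> T}) :
  finit (fmap f x) = fmap f (finit x).
Proof. by apply/ffunP=> i; rewrite !ffunE. Qed.

Lemma finit_fupdate_widen (T : Type) n (x : {ffun 'I_n.+1 -> T}) i v :
  finit (fupdate x (widen_ord (leqnSn n) i) v) = fupdate (finit x) i v.
Proof. by apply/ffunP=> j; rewrite !ffunE -val_eqE. Qed.

Lemma finit_fupdate_max (T : Type) n (x : {ffun 'I_n.+1 -> T}) v :
  finit (fupdate x ord_max v) = finit x.
Proof. by apply/ffunP=> j; rewrite !ffunE -val_eqE /= ltn_eqF. Qed.

Lemma finit_fsnoc (T : Type) n (x : {ffun 'I_n -> T}) z :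
  finit (fsnoc (n := n.+1) x z) = x.
Proof.
apply/ffunP=> j; rewrite !ffunE insubT //= => jn.
by congr (x _); apply: val_inj.
Qed.

Lemma fsnoc_max (T : Type) n (x : {ffun 'I_n -> T}) z :
  fsnoc (n := n.+1) x z ord_max = z.
Proof. by rewrite ffunE insubF //= ltnn. Qed.

Lemma fupdate_eq (T : Type) n (x : {ffun 'I_n -> T}) i v : fupdate x i v i = v.
Proof. by rewrite ffunE eqxx. Qed.

Lemma fupdate_widen_max (T : Type) n (x : {ffun 'I_n.+1 -> T}) i v :
  fupdate x (widen_ord (leqnSn n) i) v ord_max = x ord_max.
Proof. by rewrite ffunE -val_eqE /= gtn_eqF. Qed.

Lemma fmap_comp (T : Type) n (f h : T -> T) (x : {ffun 'I_n -> T}) :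
  fmap f (fmap h x) = fmap (f \o h) x.
Proof. by apply/ffunP=> i; rewrite !ffunE. Qed.

Lemma ord_widen_or_max n (i : 'I_n.+1) :
  (exists j, i = widen_ord (leqnSn n) j) \/ i = ord_max.
Proof.
case: (unliftP ord_max i) => [j ->|->]; [left; exists j|by right].
by apply: val_inj; rewrite /= /bump leqNgt ltn_ord.
Qed.

Section IteratedBracket.

Variables (K : fieldType) (V : lmodType K).
Variables (br : {bilinear V -> V -> V}) (alpha : {linear V -> V}).
Hypothesis homLie : mult_homLie_algebra br alpha.

Local Notation ib := (@iterated_bracket K V br alpha _).

Lemma iterated_bracketS n (x : {ffun 'I_n.+2 -> V}) :
  ib x = br (ib (finit x)) (iter n alpha (x ord_max)).
Proof. by []. Qed.

Lemma iter_linear k : linear (iter k alpha).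
Proof. by elim: k => [|k IH] a x y //=; rewrite IH linearP. Qed.

Lemma iterated_bracket_multilinear n :
  multilinear (@iterated_bracket K V br alpha n).
Proof.
elim: n => [|[|n] IH] x i; first by have := ltn_ord i.
  by move=> a u v; rewrite /= (ord1 ord_max) (ord1 i) !fupdate_eq.
case: (ord_widen_or_max i) => [[j ->]|->] a u v; rewrite !iterated_bracketS.
  rewrite !finit_fupdate_widen !fupdate_widen_max.
  by rewrite (IH (finit x) j a u v) linearPl.
by rewrite !finit_fupdate_max !fupdate_eq iter_linear linearPr.
Qed.

Lemma iter_br k x y :
  iter k alpha (br x y) = br (iter k alpha x) (iter k alpha y).
Proof. by elim: k => //= k ->; rewrite (homLie_mult homLie). Qed.

(** Each power of [alpha] is a morphism for [br] and commutes with the other powers of [alpha], so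
    it passes through every level of the nesting. With [k] the length minus one this is
    multiplicativity of the system. *)
Lemma iter_iterated_bracket k n (x : {ffun 'I_n -> V}) :
  iter k alpha (ib x) = ib (fmap (iter k alpha) x).
Proof.
elim: n x => [|[|n] IH] x.
- by elim: k => //= k ->; rewrite linear0.
- by rewrite /= ffunE.
rewrite !iterated_bracketS iter_br IH finit_fmap ffunE.
by rewrite -!iterD addnC.
Qed.

Lemma homLie_leibniz a b c :
  br (alpha a) (br b c) = br (br a b) (alpha c) + br (alpha b) (br a c).
Proof.
have /eqP := homLie_jacobi homLie a b c; rewrite -addrA addr_eq0 => /eqP ->.
rewrite opprD addrC (homLie_skew homLie (br a b)); congr (_ + _).
by rewrite (homLie_skew homLie c a) linearNr opprK.
Qed.

(** The bracket has length [n.+1], so [n] is $m-1$ in the formula above. *)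
Lemma iterated_bracket_leibniz n u (z : {ffun 'I_n.+1 -> V}) :
  br (iter n alpha u) (ib z) =
  \sum_(i < n.+1) ib (fupdate (fmap alpha z) i (br u (z i))).
Proof.
elim: n z => [|n IH] z.
  by rewrite big_ord1 /= (ord1 ord_max) fupdate_eq.
(* The rule is applied with $a = \alpha^n u$, $b$ the bracket of the prefix of $z$ and $c =
   \alpha^n$ of its last entry. The induction hypothesis expands $[[a,b],\alpha c]$ into the terms
   that alter a prefix entry. *)
rewrite iterated_bracketS [iter n.+1 _ _]/= homLie_leibniz IH [RHS]big_ord_recr.
rewrite linear_sumlz; congr (_ + _).
  apply: eq_bigr => i _; rewrite iterated_bracketS finit_fupdate_widen.
  by rewrite finit_fmap fupdate_widen_max !ffunE -iterSr.
(* The term altering the last entry is $[\alpha b,[a,c]]$, since $[a,c] = \alpha^n [u, z_{last}]$ by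
   multiplicativity. *)
rewrite iterated_bracketS finit_fupdate_max fupdate_eq finit_fmap iter_br.
by rewrite -[alpha (ib _)]/(iter 1 alpha _) iter_iterated_bracket.
Qed.

(** The innermost bracket $[x_1,x_2]$ vanishes, and left linearity carries this zero outwards. *)
Lemma iterated_bracket_alt n (x : {ffun 'I_n -> V}) (i j : 'I_n) :
  [pchar K] =i pred0 -> val i = 0%N -> val j = 1%N -> x i = x j -> ib x = 0.
Proof.
move=> charK0; elim: n x i j => [|[|n] IH] x i j i0 j1 xij;
  first by have := ltn_ord i.
  by have := ltn_ord j; rewrite [nat_of_ord j]j1.
rewrite iterated_bracketS; case: n IH x i j i0 j1 xij => [|n] IH x i j i0 j1 xij.
  have -> : ib (finit x) = x ord_max.
    rewrite /= ffunE -[ord_max in RHS](_ : j = _) -?xij; last exact: val_inj.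
    by congr (x _); apply: val_inj.
  (* Skew-symmetry at $(v,v)$ gives $2[v,v]=0$, and $2 \neq 0$ in characteristic zero. *)
  set v := x ord_max; have /eqP := homLie_skew homLie v v.
  rewrite -addr_eq0 -mulr2n -scaler_nat scaler_eq0 => /orP[|/eqP //].
  by have := charK0 2; rewrite !inE /= => ->.
rewrite (IH (finit x) (Ordinal (ltn0Sn n.+1)) (Ordinal (isT : (1 < n.+2)%N))) //.
  by rewrite linear0l.
rewrite !ffunE; have -> : widen_ord (leqnSn n.+2) (Ordinal (ltn0Sn n.+1)) = i.
  exact: val_inj.
by rewrite xij; congr (x _); apply: val_inj.
Qed.

Lemma iterated_bracket_jacobi n (x : {ffun 'I_n.+1 -> V})
    (y : {ffun 'I_n.+2 -> V}) :
  ib (fsnoc (n := n.+2) (fmap (iter n.+1 alpha) x) (ib y)) =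
  \sum_(i < n.+2) ib (fupdate (fmap (iter n.+1 alpha) y) i
                        (ib (fsnoc (n := n.+2) x (y i)))).
Proof.
(* The left side becomes $[\alpha^{n+1} b(x), \alpha^n b(y)]$. Moving $\alpha^n$ onto the entries of
   $y$ gives the shape of [iterated_bracket_leibniz]. *)
rewrite iterated_bracketS finit_fsnoc fsnoc_max -iter_iterated_bracket.
rewrite (iter_iterated_bracket n y) iterated_bracket_leibniz.
apply: eq_bigr => i _.
(* Each altered entry $[b(x), \alpha^n y_i]$ is the bracket of $x$ followed by $y_i$, and the
   remaining entries are $\alpha(\alpha^n y_j)$. *)
rewrite (iterated_bracketS (fsnoc (n := n.+2) x (y i))) finit_fsnoc fsnoc_max.
by rewrite fmap_comp ffunE.
Qed.

End IteratedBracket.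

Theorem theorem3p11 (K : closedFieldType) (charK0 : [pchar K] =i pred0)
    (g : lmodType K) (br : {bilinear g -> g -> g}) (alpha : {linear g -> g})
    (g_homLie : mult_homLie_algebra br alpha)
    (n : nat) (n_ge2 : (2 <= n)%N) :
  mult_homLie_nuplet_system (@iterated_bracket K g br alpha n)
    (iter n.-1 alpha).
Proof.
case: n n_ge2 => [|[|n]] // _; split.
- exact: iterated_bracket_multilinear.
- exact: iter_linear.
- by move=> x i j; apply: iterated_bracket_alt.
- exact: iterated_bracket_jacobi.
- by move=> x; apply: iter_iterated_bracket.
Qed.
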